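(* Let $\mathfrak{q}=\mathfrak{l}\oplus\mathfrak{g}(1)\oplus\mathfrak{z}(\mathfrak{n})$ be a maximal parabolic subalgebra of quasi-Heisenberg type of one of the types $B_n(i)$ ($3\le i\le n$), $C_n(i)$ ($2\le i\le n-1$), $D_n(i)$ ($3\le i\le n-3$), $E_6(3)$, $E_6(5)$, $E_7(2)$, $E_7(6)$, $E_8(1)$, $F_4(4)$. If $V(\mu+\epsilon)$ is a special constituent of $\mathfrak{l}\otimes\mathfrak{z}(\mathfrak{n})$ of type 1a, then for any $\alpha\in\Delta_{\mu+\epsilon}(\mathfrak{g}(1))$ and any $\gamma_j\in\Delta_{\mu+\epsilon}(\mathfrak{z}(\mathfrak{n}))$ we have $\gamma_j-\alpha\in\Delta$.
   Context: $\mathfrak{g}$ is a complex simple Lie algebra with Borel subalgebra $\mathfrak{b}\supset\mathfrak{h}$ (Cartan), roots $\Delta$, simple roots $\Pi$. ''$\mathfrak{q}$ is of type $\mathcal{T}(i)$'' means $\mathfrak{g}$ has type $\mathcal{T}$ and $\mathfrak{q}=\mathfrak{l}\oplus\mathfrak{n}$ is the standard maximal parabolic determined by $\alpha_\mathfrak{q}=\alpha_i$ (Bourbaki numbering): $\mathfrak{l}=\mathfrak{h}$ plus root spaces for roots in $\mathrm{span}(\Pi\setminus\{\alpha_\mathfrak{q}\})$, $\mathfrak{n}$ the remaining positive root spaces. Quasi-Heisenberg type: $[\mathfrak{n},[\mathfrak{n},\mathfrak{n}]]=0$, $\dim[\mathfrak{n},\mathfrak{n}]>1$. $\mathfrak{n}=\mathfrak{g}(1)\oplus\mathfrak{z}(\mathfrak{n})$,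 where $\mathfrak{g}(1)$ (resp. the center $\mathfrak{z}(\mathfrak{n})$) is the sum of the root spaces of roots with $\alpha_\mathfrak{q}$-coefficient $1$ (resp. $2$). $L$ is the Levi subgroup with Lie algebra $\mathfrak{l}$, acting by $\mathrm{Ad}$. $\Delta(W)$ denotes the roots whose root spaces lie in $W$, and $\Delta_\nu(W)=\{\alpha\in\Delta(W):\nu-\alpha\in\Delta\}$. $\mu$ is the highest weight of the irreducible $L$-module $\mathfrak{g}(1)$ and $\gamma$ (the highest root) that of $\mathfrak{z}(\mathfrak{n})$. An irreducible $L$-constituent $V(\nu)$ (highest weight $\nu$) of $\mathfrak{l}\otimes\mathfrak{z}(\mathfrak{n})$ is special if $\nu\neq\gamma$ and $\nu=\mu+\epsilon$ for some $\epsilon\in\Delta(\mathfrak{g}(1))$; it is of type 1a if $\mu+\epsilon\notin\Delta$, $\epsilon\neq\mu$, and both $\mu$ and $\epsilon$ are long roots (all roots are regarded as long if $\mathfrak{g}$ is simply laced). *)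

(* Defs.v *)
From HB Require Import structures.
From mathcomp Require Import all_boot all_order all_algebra.
From mathcomp Require Import all_classical all_reals all_analysis.
From mathcomp Require Import complex.
Set Implicit Arguments.
Unset Strict Implicit.
Unset Printing Implicit Defensive.
Import Order.TTheory GRing.Theory Num.Theory.
Import numFieldNormedType.Exports passmx.
Local Open Scope classical_set_scope.
Local Open Scope ring_scope.

HB.mixin Record Vector_isLieAlgebra (K : fieldType) g of Vector K g := {
  lie : g -> g -> g;
  lie_linearl : forall (a : K) (x y z : g),
    lie (a *: x + y) z = a *: lie x z + lie y z;
  lie_linearr : forall (a : K) (x y z : g),
    lie z (a *: x + y) = a *: lie z x + lie z y;
  liexx : forall x : g, lie x x = 0;
  lie_jacobi : forall x y z : g,
    lie x (lie y z) + lie y (lie z x) + lie z (lie x y) = 0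
}.

#[short(type="lieAlgebraType")]
HB.structure Definition LieAlgebra (K : fieldType) :=
  {g of Vector_isLieAlgebra K g & Vector K g}.

Section LieAlgebra.
Variables (K : fieldType) (g : lieAlgebraType K).
Implicit Types (U V I h : {vspace g}) (x y : g).

Fact lie_is_linear x : linear (lie x : g -> g).
Proof. by move=> a y z; rewrite lie_linearr. Qed.

HB.instance Definition _ x :=
  GRing.isLinear.Build K g g *:%R (lie x) (lie_is_linear x).

Definition ad x : 'End(g) := linfun (lie x).

Definition liev U V : {vspace g} :=
  <<[seq lie u v | u <- vbasis U, v <- vbasis V]>>%VS.

Definition simple_lie : Prop :=
  liev fullv fullv <> 0%VS /\
  forall I, (liev fullv I <= I)%VS -> I = 0%VS \/ I = fullv.

Definition killing x y : K :=
  \tr (mxof (vbasis {:g}) (vbasis {:g}) (ad x \o ad y)%VF).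

Definition ad_diagonalizable x : Prop :=
  exists2 X : seq g, basis_of {:g} X &
    forall v, v \in X -> exists c : K, lie x v = c *: v.

(* Cartan subalgebras of a semisimple Lie algebra: maximal abelian, acting
   diagonalizably *)
Definition cartan_subalgebra h : Prop :=
  [/\ forall x y, x \in h -> y \in h -> lie x y = 0,
      forall x, (forall y, y \in h -> lie y x = 0) -> x \in h
    & forall x, x \in h -> ad_diagonalizable x].

End LieAlgebra.

Section Tensor.
Variables (K : fieldType) (g : lieAlgebraType K).
Local Notation b := (vbasis {:g}).

(* The tensor square of [g], in coordinates: [u (x) v] is the matrix of the
   products of the coordinates of [u] and [v]. *)
Local Notation tensor2 := 'M[K]_(\dim {:g}).

Definition tens (u v : g) : tensor2 := (rVof b u)^T *m rVof b v.

Definition tensv (U V : {vspace g}) : {vspace tensor2} :=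
  <<[seq tens u v | u <- vbasis U, v <- vbasis V]>>%VS.

Definition tens_group_fun (phi : 'End(g)) (M : tensor2) : tensor2 :=
  (mxof b b phi)^T *m M *m mxof b b phi.

Definition tens_lie_fun (x : g) (M : tensor2) : tensor2 :=
  (mxof b b (ad x))^T *m M + M *m mxof b b (ad x).

Fact tens_group_fun_is_linear phi : linear (tens_group_fun phi).
Proof.
by move=> a M N; rewrite /tens_group_fun mulmxDr mulmxDl -scalemxAr -scalemxAl.
Qed.

HB.instance Definition _ phi := GRing.isLinear.Build K tensor2 tensor2 *:%R
  (tens_group_fun phi) (tens_group_fun_is_linear phi).

Fact tens_lie_fun_is_linear x : linear (tens_lie_fun x).
Proof.
move=> a M N; rewrite /tens_lie_fun mulmxDr mulmxDl.
by rewrite -scalemxAr -scalemxAl scalerDr addrACA.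
Qed.

HB.instance Definition _ x := GRing.isLinear.Build K tensor2 tensor2 *:%R
  (tens_lie_fun x) (tens_lie_fun_is_linear x).

Definition tens_group_act phi : 'End(tensor2) := linfun (tens_group_fun phi).
Definition tens_lie_act x : 'End(tensor2) := linfun (tens_lie_fun x).

Lemma tens_group_actE phi u v :
  tens_group_act phi (tens u v) = tens (phi u) (phi v).
Proof.
rewrite /tens_group_act lfunE /= /tens_group_fun /tens.
by rewrite !(rVof_app b (vbasisP _)) trmx_mul !mulmxA.
Qed.

Lemma tens_lie_actE x u v :
  tens_lie_act x (tens u v) = tens (lie x u) v + tens u (lie x v).
Proof.
have adE w : rVof b (lie x w) = rVof b w *m mxof b b (ad x).
  by rewrite -(rVof_app b (vbasisP _)) lfunE.
rewrite /tens_lie_act lfunE /= /tens_lie_fun /tens !adE.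
by rewrite trmx_mul !mulmxA.
Qed.

End Tensor.

Section Roots.
Variables (R : realType) (g : lieAlgebraType R[i]) (h : {vspace g}).
Local Notation C := R[i].

Definition dual := 'Hom(subvs_of h, C^o).
HB.instance Definition _ := Vector.on dual.
Implicit Types (al be nu : dual) (U V W : {vspace g}).

Definition root_space al : {vspace g} :=
  (\bigcap_(H <- vbasis {:subvs_of h})
     lker (ad (vsval H) - (al H : C) *: \1%VF))%VS.

Definition lie_roots : set dual :=
  [set al | al <> 0 /\ root_space al <> 0%VS].

Definition sum_root_spaces (A : set dual) : {vspace g} :=
  \big[addv/0%VS]_(al \in A) root_space al.

Definition roots_of W : set dual :=
  [set al | lie_roots al /\ (root_space al <= W)%VS].

Definition roots_of_at nu W : set dual :=
  [set al | roots_of W al /\ lie_roots (nu - al)].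

(* the vector of [h] representing [al] through the Killing form *)
Definition killing_dual al : subvs_of h :=
  xget 0 [set t | forall H : subvs_of h,
                    killing (vsval t) (vsval H) = (al H : C)].

Definition dual_form al be : C :=
  killing (vsval (killing_dual al)) (vsval (killing_dual be)).

(* If [g] is simply laced, all roots have the same length, hence all are long. *)
Definition long_root al : Prop :=
  lie_roots al /\ forall be, lie_roots be -> dual_form be be <= dual_form al al.

Definition nat_comb n (Pi : n.-tuple dual) be : Prop :=
  exists k : 'I_n -> nat, be = \sum_j tnth Pi j *+ k j.

(* A base of the root system; the Borel subalgebra it determines is the sum of
   [h] and of the root spaces of the positive roots. *)
Definition simple_roots n (Pi : n.-tuple dual) : Prop :=
  [/\ basis_of {:dual} Pi,
      forall j, lie_roots (tnth Pi j)
    & forall be, lie_roots be -> nat_comb Pi be \/ nat_comb Pi (- be)].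

Definition positive_roots n (Pi : n.-tuple dual) : set dual :=
  [set be | lie_roots be /\ nat_comb Pi be].

End Roots.

Inductive cartan_type :=
  TypeA of nat | TypeB of nat | TypeC of nat | TypeD of nat
| TypeE6 | TypeE7 | TypeE8 | TypeF4 | TypeG2.

Definition cartan_rank T :=
  match T with
  | TypeA n | TypeB n | TypeC n | TypeD n => n
  | TypeE6 => 6 | TypeE7 => 7 | TypeE8 => 8 | TypeF4 => 4 | TypeG2 => 2
  end.

(* The edges (i, j) with i < j of the Dynkin diagrams, nodes being numbered from
   1 as in Bourbaki. *)
Definition dynkin_edge T (i j : nat) : bool :=
  match T with
  | TypeD n => ((j == i.+1) && (j < n)) || ((j == i.+2) && (j == n))
  | TypeE6 | TypeE7 | TypeE8 =>
      [|| (i, j) == (1, 3), (i, j) == (2, 4) | (2 < i) && (j == i.+1)]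
  | _ => j == i.+1
  end%N.

(* - <alpha_i, alpha_j^vee> for adjacent nodes i and j: greater than 1 exactly
   when alpha_i is longer than alpha_j *)
Definition bond T (i j : nat) : nat :=
  match T with
  | TypeB n => if (i == n.-1) && (j == n) then 2 else 1
  | TypeC n => if (i == n) && (j == n.-1) then 2 else 1
  | TypeF4 => if (i == 2) && (j == 3) then 2 else 1
  | TypeG2 => if (i == 2) && (j == 1) then 3 else 1
  | _ => 1
  end%N.

Definition cartan_entry T (i j : nat) : int :=
  if i == j then 2
  else if dynkin_edge T i j || dynkin_edge T j i then - (bond T i j)%:Z
  else 0.

Definition lemma_types T (i : nat) : bool :=
  match T with
  | TypeB n => 3 <= i <= n
  | TypeC n => 2 <= i <= n - 1
  | TypeD n => 3 <= i <= n - 3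
  | TypeE6 => (i == 3) || (i == 5)
  | TypeE7 => (i == 2) || (i == 6)
  | TypeE8 => i == 1
  | TypeF4 => i == 4
  | _ => false
  end%N.

Section Parabolic.
Variables (R : realType) (g : lieAlgebraType R[i]) (h : {vspace g}).
Local Notation C := R[i].
Local Notation dual := (dual h).

Definition has_type T (Pi : (cartan_rank T).-tuple dual) : Prop :=
  [/\ cartan_subalgebra h, simple_roots Pi
    & forall i j, 2 * dual_form (tnth Pi i) (tnth Pi j)
                    / dual_form (tnth Pi j) (tnth Pi j)
                  = (cartan_entry T i.+1 j.+1)%:~R].

Variables (n : nat) (Pi : n.-tuple dual) (q : 'I_n).
Implicit Types (al be nu mu gam eps : dual).

Definition roots_levi : set dual :=
  [set be | lie_roots be /\
     be \in <<[seq tnth Pi j | j <- enum 'I_n & j != q]>>%VS].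

Definition levi : {vspace g} := (h + sum_root_spaces roots_levi)%VS.

Definition nilradical : {vspace g} :=
  sum_root_spaces [set be | positive_roots Pi be /\ ~ roots_levi be].

Definition graded (k : nat) : {vspace g} :=
  sum_root_spaces [set be | lie_roots be /\ coord Pi q be = k%:R].

Definition g1 := graded 1.
Definition zn := graded 2.

Definition quasi_heisenberg : Prop :=
  liev nilradical (liev nilradical nilradical) = 0%VS /\
  (1 < \dim (liev nilradical nilradical))%N.

(* [phi] is the exponential of [f], entrywise in matrices *)
Definition is_exp (f phi : 'End(g)) : Prop :=
  let b := vbasis {:g} in
  forall i j,
    (fun N : nat => (\sum_(k < N) (k`!%:R : C)^-1 *: mxof b b f ^+ k) i j) @ \oo
      --> (mxof b b phi i j : C^o).

(* The image of the Levi subgroup under Ad: [L] is connected, hence generated by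
   the exponentials of the elements of its Lie algebra. *)
Inductive AdL : 'End(g) -> Prop :=
| AdL_exp x phi of x \in levi & is_exp (ad x) phi : AdL phi
| AdL_comp phi psi of AdL phi & AdL psi : AdL (phi \o psi)%VF.

Section Modules.
(* an [L]-module, by its action of AdL and the derived action of [levi] *)
Variables (W : vectType C) (rho : 'End(g) -> 'End(W)) (drho : g -> 'End(W)).

Definition L_submodule (U : {vspace W}) : Prop :=
  forall phi, AdL phi -> (rho phi @: U <= U)%VS.

Definition L_irreducible (U : {vspace W}) : Prop :=
  [/\ U <> 0%VS, L_submodule U
    & forall U', L_submodule U' -> (U' <= U)%VS -> U' = 0%VS \/ U' = U].

Definition is_highest_weight (U : {vspace W}) nu : Prop :=
  exists v, [/\ v \in U, v <> 0,
    forall H : subvs_of h, drho (vsval H) v = (nu H : C) *: v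
  & forall al x, positive_roots Pi al -> roots_levi al -> x \in root_space al ->
      drho x v = 0].

(* [L] is reductive, so the irreducible constituents are the irreducible
   submodules. *)
Definition has_constituent (U : {vspace W}) nu : Prop :=
  exists V : {vspace W},
    [/\ (V <= U)%VS, L_irreducible V & is_highest_weight V nu].

End Modules.

Definition highest_weight_in_g (U : {vspace g}) nu : Prop :=
  is_highest_weight (@ad _ g) U nu.

Definition constituent_l_zn nu : Prop :=
  has_constituent (@tens_group_act _ g) (@tens_lie_act _ g) (tensv levi zn) nu.

Definition special mu gam nu : Prop :=
  [/\ constituent_l_zn nu, nu <> gam
    & exists2 eps, roots_of g1 eps & nu = mu + eps].

Definition type1a mu eps : Prop :=
  [/\ ~ lie_roots (mu + eps), eps <> mu, long_root mu & long_root eps].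

End Parabolic.

(* Main.v *)
(* With roots normalised by [M = (mu, mu)], the squared length of a long root,
   integrality gives [2 (b, mu) <= M] for every root [b <> mu].  If
   [mu + eps = gj + be] with [gj, be] roots other than [mu, eps], pairing with
   [mu] and with [eps] forces [(mu, eps) = 0], equality in all these bounds, and
   then [(gj, gj) = M].  Finally, if [mu + eps = al + al'], then
   [2 (gj, al) + 2 (gj, al') = 2 M] with both terms at most [M], so [(gj, al) > 0]
   and [gj - al] is a root.  Nondegeneracy of the Killing form, from which the
   root strings are built, needs no Cartan criterion: a Cartan matrix makes the
   form nonzero, and its radical is an ideal of a simple algebra. *)
From HB Require Import structures.
Require Import Defs.
From mathcomp Require Import all_boot all_order all_algebra.
From mathcomp Require Import all_classical all_reals all_analysis.
From mathcomp Require Import complex.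
From mathcomp Require Import ring lra.
Set Implicit Arguments.
Unset Strict Implicit.
Unset Printing Implicit Defensive.
Import Order.TTheory GRing.Theory Num.Theory.
Import passmx.
Local Open Scope ring_scope.

Section LieBracket.
Variables (K : fieldType) (g : lieAlgebraType K).
Implicit Types x y z : g.

Lemma lieDl x y z : lie (x + y) z = lie x z + lie y z.
Proof. by rewrite -[x]scale1r lie_linearl !scale1r. Qed.

Lemma lie_opp x y : lie x y = - lie y x.
Proof.
apply/eqP; rewrite -addr_eq0; apply/eqP.
by have := liexx (x + y); rewrite lieDl !linearD /= !liexx add0r addr0.
Qed.

Lemma lie_lie x y z : lie x (lie y z) = lie (lie x y) z + lie y (lie x z).
Proof.
have /eqP := lie_jacobi x y z.
rewrite -addrA addr_eq0 => /eqP ->.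
by rewrite (lie_opp x z) linearN /= (lie_opp z (lie x y)) opprD opprK addrC.
Qed.

Local Notation b := (vbasis {:g}).

Definition admx x : 'M[K]_(\dim {:g}) := mxof b b (ad x).

Lemma admxE x y : rVof b (lie x y) = rVof b y *m admx x.
Proof. by rewrite /admx -(rVof_app _ (vbasisP _)) lfunE. Qed.

Lemma admx_is_linear : linear admx.
Proof.
move=> a x y; rewrite /admx -linearP; congr (mxof _ _ _).
by apply/lfunP => z; rewrite add_lfunE scale_lfunE !lfunE /= lie_linearl.
Qed.

HB.instance Definition _ := GRing.isLinear.Build K g 'M[K]_(\dim {:g}) *:%R
  admx admx_is_linear.

Lemma admx_lie x y : admx (lie x y) = admx y *m admx x - admx x *m admx y.
Proof.
rewrite /admx -!(mxof_comp _ _ (vbasisP _)) -linearB; congr (mxof _ _ _).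
apply/lfunP => z; rewrite add_lfunE opp_lfunE !comp_lfunE !lfunE /=.
by rewrite (lie_lie x y) addrK.
Qed.

Lemma killingE x y : killing x y = \tr (admx x *m admx y).
Proof. by rewrite /killing (mxof_comp _ _ (vbasisP _)) mxtrace_mulC. Qed.

Lemma killingC x y : killing x y = killing y x.
Proof. by rewrite !killingE mxtrace_mulC. Qed.

Lemma killing_is_linear x : linear (killing x : g -> K^o).
Proof.
by move=> a y z; rewrite !killingE linearP /= mulmxDr -scalemxAr linearP.
Qed.

HB.instance Definition _ x := GRing.isLinear.Build K g K^o *:%R
  (killing x : g -> K^o) (killing_is_linear x).

Lemma killingZr a x y : killing x (a *: y) = a * killing x y.
Proof. by rewrite linearZ. Qed.

Lemma killing_lie x y z : killing (lie x y) z = killing x (lie y z).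
Proof.
rewrite !killingE !admx_lie mulmxBl mulmxBr !linearB /= !mulmxA.
by rewrite addrC [in RHS]addrC; congr (_ + _); rewrite -!mulmxA mxtrace_mulC !mulmxA.
Qed.

Lemma memv_bigcap_seq (vT : vectType K) I (r : seq I) (U : I -> {vspace vT}) v :
  (v \in \bigcap_(i <- r) U i)%VS = all (fun i => v \in U i) r.
Proof.
elim: r => [|i r IHr]; first by rewrite big_nil memvf.
by rewrite big_cons memv_cap IHr.
Qed.

(* The radical of the Killing form is an ideal. *)
Lemma simple_killing_nondeg : simple_lie g ->
  (exists x y : g, killing x y != 0) ->
  forall x, (forall y, killing x y = 0) -> x = 0.
Proof.
case=> _ ideal [x0 [y0 xy0]] x x_rad.
pose rad := (\bigcap_(y <- b) lker (linfun (killing y : g -> K^o)))%VS.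
have radP z : z \in rad <-> (forall y, killing z y = 0).
  rewrite memv_bigcap_seq; split=> [/allP zr y|zr].
    rewrite (coord_vbasis (memvf y)) linear_sum big1 // => i _.
    have ib : b`_i \in b by rewrite mem_nth ?size_tuple.
    have := zr _ ib; rewrite memv_ker lfunE /= killingC => /eqP zi.
    by rewrite linearZ /= zi scaler0.
  by apply/allP => y _; rewrite memv_ker lfunE /= killingC zr.
case: (ideal rad) => [|rad0|radT].
- apply/span_subvP => _ /allpairsP[[u v] /= [_ /vbasis_mem/radP vr ->]].
  apply/radP => y; rewrite lie_opp killingC linearN /= killingC killing_lie.
  by rewrite vr oppr0.
- by apply/eqP; rewrite -memv0 -rad0; apply/radP.
- have /radP x00 : x0 \in rad by rewrite radT memvf.
  by rewrite x00 eqxx in xy0.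
Qed.

Lemma ad_diagonalizable_admx x : ad_diagonalizable x -> diagonalizable (admx x).
Proof.
case=> X Xb Xx.
have sX : size X == \dim {:g}.
  by rewrite eq_sym -(span_basis Xb); exact: basis_free Xb.
pose tX := Tuple sX.
have tXb : basis_of {:g} tX by [].
pose P := \matrix_(i < \dim {:g}) rVof b tX`_i.
have P_full : row_full P.
  rewrite -sub1mx; apply/rV_subP => u _.
  rewrite -[u](vecofK (vbasisP _)).
  rewrite (coord_basis tXb (memvf (vecof b u))) linear_sum /= summx_sub // => i _.
  have -> : rVof b (coord tX i (vecof b u) *: tX`_i) =
            coord tX i (vecof b u) *: row i P by rewrite rowK linearZ.
  by rewrite scalemx_sub // row_sub.
have Xc (i : 'I_(\dim {:g})) : exists c : K, lie x tX`_i = c *: tX`_i.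
  by apply: Xx; rewrite mem_nth ?(eqP sX).
pose c (i : 'I_(\dim {:g})) : K := projT1 (cid (Xc i)).
have cE (i : 'I_(\dim {:g})) : lie x tX`_i = c i *: tX`_i := projT2 (cid (Xc i)).
have Pu : P \in unitmx by rewrite -row_full_unit.
exists P => //; apply/diagonalizable_forPex; exists (\row_i c i).
apply/simmxP => //; apply/row_matrixP => i; rewrite row_mul rowK -admxE cE.
by apply/rowP => j; rewrite mul_diag_mx !mxE linearZ.
Qed.

End LieBracket.

Section Weights.
Variables (R : realType) (g : lieAlgebraType R[i]) (h : {vspace g}).
Local Notation C := R[i].
Local Notation dual := (dual h).
Local Notation b := (vbasis {:g}).
Implicit Types (al be nu : dual) (H : subvs_of h) (x y v : g).

Lemma root_spaceP al v :
  v \in root_space al <-> forall H, lie (vsval H) v = (al H : C) *: v.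
Proof.
rewrite /root_space memv_bigcap_seq; split=> [/allP vV H|vV]; last first.
  apply/allP => H _.
  by rewrite memv_ker add_lfunE opp_lfunE scale_lfunE id_lfunE lfunE /= vV subrr.
have {}vV i : lie (vsval (vbasis {:subvs_of h})`_i) v
              = (al (vbasis {:subvs_of h})`_i : C) *: v.
  case: (ltnP i (\dim {:subvs_of h})) => [i_lt|i_ge].
    have iV : (vbasis {:subvs_of h})`_i \in vbasis {:subvs_of h}.
      by rewrite mem_nth ?size_tuple.
    have := vV _ iV.
    by rewrite memv_ker add_lfunE opp_lfunE scale_lfunE id_lfunE lfunE subr_eq0 => /eqP.
  by rewrite nth_default ?size_tuple // !linear0 lie_opp linear0 oppr0 scale0r.
rewrite lie_opp [in LHS](coord_vbasis (memvf H)) linear_sum linear_sum -sumrN.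
rewrite [in RHS](coord_vbasis (memvf H)) linear_sum scaler_suml.
apply: eq_bigr => i _.
by rewrite !linearZ /= -lie_opp vV scalerA.
Qed.

Lemma lie_root_space al be x y :
  x \in root_space al -> y \in root_space be -> lie x y \in root_space (al + be).
Proof.
move=> /root_spaceP xV /root_spaceP yV; apply/root_spaceP => H.
rewrite lie_lie xV yV linearZ /= lie_opp linearZ /= -scalerN -lie_opp.
by rewrite add_lfunE scalerDl.
Qed.

Lemma dual_eq0P al : al <> 0 <-> exists H, al H != 0 :> C.
Proof.
split=> [al0|[H alH] al0]; last by rewrite al0 zero_lfunE eqxx in alH.
apply: contra_notP al0 => /forallNP alH; apply/lfunP => H; rewrite zero_lfunE.
by apply/eqP; have /negP := alH H; rewrite negbK.
Qed.

Lemma killing_root_space al be x y :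
  x \in root_space al -> y \in root_space be -> al + be <> 0 -> killing x y = 0.
Proof.
move=> /root_spaceP xV /root_spaceP yV /dual_eq0P[H abH].
have : killing (lie x (vsval H)) y = killing x (lie (vsval H) y).
  by rewrite killing_lie.
rewrite lie_opp xV yV killingC linearN !linearZ /= killingC => E.
have {}E : (al H : C) * - killing x y = (be H : C) * killing x y := E.
have /eqP : ((al + be) H : C) * killing x y = 0.
  by rewrite add_lfunE mulrDl -E mulrN subrr.
by rewrite mulf_eq0 (negPf abH) => /eqP.
Qed.

Lemma sum_root_spaces_mem (A : set dual) nu v w :
  v \in root_space nu -> v \in sum_root_spaces A -> w \in root_space (- nu) ->
  killing w v != 0 -> A nu.
Proof.
move=> vnu vA wnu; apply: contra_neqP => Anu.
suff : (sum_root_spaces A <= lker (linfun (killing w : g -> C^o)))%VS.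
  by move/subvP/(_ _ vA); rewrite memv_ker lfunE => /eqP.
rewrite /sum_root_spaces big_seq; elim/big_ind: _ => [|U V sU sV|be].
- exact: sub0v.
- by rewrite subv_add sU.
move=> beA; apply/subvP => u ube; rewrite memv_ker lfunE /=; apply/eqP.
apply: killing_root_space wnu ube _ => /eqP.
rewrite addrC subr_eq0 => /eqP benu; apply: Anu; rewrite -benu.
move: beA; case: finite_supportP => //= X XA _ _; exact: XA.
Qed.

Section Cartan.
Hypothesis h_cartan : cartan_subalgebra h.

Definition diag_entry (P : 'M[C]_(\dim {:g})) (i : 'I_(\dim {:g}))
  (H : subvs_of h) : C^o := (P *m admx (vsval H) *m invmx P) i i.

Fact diag_entry_is_linear P i : linear (diag_entry P i).
Proof.
move=> a x y; rewrite /diag_entry !linearP /= mulmxDl -scalemxAl.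
by rewrite !mxE.
Qed.

HB.instance Definition _ P i := GRing.isLinear.Build C (subvs_of h) C^o *:%R
  (diag_entry P i) (diag_entry_is_linear P i).

Lemma cartan_codiagonalizable : exists2 P : 'M[C]_(\dim {:g}),
  P \in unitmx & forall H, diagonalizable_for P (admx (vsval H)).
Proof.
have [h_ab _ h_diag] := h_cartan.
pose As := [seq admx (vsval H) | H <- vbasis {:subvs_of h}].
have [P Pu PAs] : codiagonalizable As.
  apply/codiagonalizableP; split=> [_ _ /mapP[H _ ->] /mapP[H' _ ->]|_ /mapP[H _ ->]].
    apply/eqP; rewrite -subr_eq0 -admx_lie h_ab ?subvsP //.
    by rewrite linear0.
  by apply: ad_diagonalizable_admx; apply: h_diag; exact: subvsP.
exists P => // H; apply/diagonalizable_forP => // i j ij.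
rewrite (coord_vbasis (memvf H)) !linear_sum mulmx_suml summxE.
rewrite big1 // => k _.
have /(diagonalizable_forP _ Pu)/(_ i j ij) Pk :
    diagonalizable_for P (admx (vsval (vbasis {:subvs_of h})`_k)).
  by move/allP: PAs; apply; apply/map_f; rewrite mem_nth ?size_tuple.
by rewrite !linearZ /= -scalemxAl mxE Pk mulr0.
Qed.

Lemma cartan_eigenbasis :
  exists (e : 'I_(\dim {:g}) -> g) (be : 'I_(\dim {:g}) -> dual),
  [/\ forall i, e i != 0, forall i, e i \in root_space (be i),
      forall v, exists c : 'I_(\dim {:g}) -> C, v = \sum_i c i *: e i
    & forall H H', killing (vsval H) (vsval H') =
        \sum_i (be i H : C) * (be i H' : C)].
Proof.
have [P Pu Pd] := cartan_codiagonalizable.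
pose be i : dual := linfun (diag_entry P i).
have PE H : P *m admx (vsval H) = diag_mx (\row_i (be i H : C)) *m P.
  rewrite -[LHS](mulmxKV Pu); congr (_ *m _); apply/matrixP => i j.
  rewrite [RHS]mxE [X in X *+ _]mxE; have [<-|ij] := eqVneq i j.
    by rewrite lfunE mulr1n.
  by have /(diagonalizable_forP _ Pu) -> := Pd H; rewrite // mulr0n.
exists (fun i => vecof b (row i P)), be; split=> [i|i|v|H H'].
- rewrite (vecof_eq0 (vbasisP _)).
  rewrite rowE mulmx_free_eq0 ?row_free_unit //.
  by apply/eqP => /matrixP/(_ 0 i)/eqP; rewrite !mxE !eqxx oner_eq0.
- apply/root_spaceP => H; apply: (can_inj (rVofK (vbasisP _))).
  rewrite admxE linearZ /= !(vecofK (vbasisP _)) -row_mul PE.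
  by apply/rowP => j; rewrite mul_diag_mx !mxE.
- exists (fun i => (rVof b v *m invmx P) 0 i).
  rewrite -[LHS](rVofK (vbasisP _)) -{1}(mulmxKV Pu (rVof b v)).
  by rewrite mulmx_sum_row linear_sum; apply: eq_bigr => i _; rewrite linearZ.
have adE H0 : admx (vsval H0) = invmx P *m diag_mx (\row_i (be i H0 : C)) *m P.
  by rewrite -mulmxA -PE mulKmx.
rewrite killingE !adE !mulmxA mulmxK // mxtrace_mulC -!mulmxA mulKVmx //.
by rewrite mulmx_diag mxtrace_diag; apply: eq_bigr => i _; rewrite !mxE.
Qed.

End Cartan.

End Weights.

Lemma string_coefficient (K : comNzRingType) (a c : K) n :
  (a - c *+ n.+1) *+ 2 + (a *+ 2 - c *+ n) *+ n.+1 =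
  (a *+ 2 - c *+ n.+1) *+ n.+2.
Proof. by ring. Qed.

Section Strings.
Variables (R : realType) (g : lieAlgebraType R[i]) (h : {vspace g}).
Local Notation C := R[i].
Local Notation dual := (dual h).
Local Notation b := (vbasis {:g}).
Implicit Types (al be nu : dual) (H : subvs_of h) (x y v : g).

Lemma iter_lie_root_space al be x v n :
  x \in root_space al -> v \in root_space be ->
  iter n (lie x) v \in root_space (be + al *+ n).
Proof.
move=> xal vbe; elim: n => [|n IHn]; first by rewrite mulr0n addr0.
have -> : be + al *+ n.+1 = al + (be + al *+ n) by rewrite mulrS addrCA.
by rewrite iterS; exact: lie_root_space xal IHn.
Qed.

(* For [al H != 0] the vectors [(ad x)^n v] are eigenvectors of [ad H] for
   pairwise distinct eigenvalues. *)
Lemma iter_lie_eventually0 al be x v :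
  al <> 0 -> x \in root_space al -> v \in root_space be -> v != 0 ->
  exists n, iter n (lie x) v != 0 /\ iter n.+1 (lie x) v = 0.
Proof.
move=> /dual_eq0P[H alH] xal vbe v0.
have [n n0] : exists n, iter n (lie x) v == 0.
  apply: contrapT => /forallNP nz.
  pose ev n : C := be H + (al H : C) *+ n.
  pose p := char_poly (admx (vsval H)).
  have p_root n : root p (ev n).
    rewrite -eigenvalue_root_char; apply/eigenvalueP.
    exists (rVof b (iter n (lie x) v)); last first.
      by rewrite (rVof_eq0 (vbasisP _)); apply/negP; exact: nz.
    have /root_spaceP/(_ H) E := iter_lie_root_space n xal vbe.
    rewrite -admxE E linearZ /=; congr (_ *: _).
    by rewrite /ev add_lfunE; congr (_ + _); elim: n {E} => [|n IHn];
      rewrite ?mulr0n ?zero_lfunE // !mulrS add_lfunE IHn.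
  have p0 : p != 0 by rewrite monic_neq0 ?char_poly_monic.
  have ev_inj : injective ev.
    by move=> m n /addrI/(mulrIn alH).
  pose rs := [seq ev n | n <- iota 0 (size p)].
  have : (size rs < size p)%N.
    apply: (max_poly_roots p0); first by apply/allP => _ /mapP[n _ ->].
    by rewrite map_inj_uniq ?iota_uniq.
  by rewrite size_map size_iota ltnn.
case: (ex_minnP (ex_intro (fun n => iter n (lie x) v == 0) n n0)).
case=> [|m /eqP m0 m_min]; first by rewrite (negPf v0).
by exists m; split=> //; apply/negP => /m_min; rewrite ltnn.
Qed.

Hypothesis h_cartan : cartan_subalgebra h.
Hypothesis killing_nondeg : forall x, (forall y, killing x y = 0) -> x = 0.
Hypothesis killing_represents : forall al, exists t : subvs_of h,
  forall H, killing (vsval t) (vsval H) = (al H : C).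

Local Notation t_ := (@killing_dual R g h).

Lemma killing_dualP al H : killing (vsval (t_ al)) (vsval H) = (al H : C).
Proof.
by have := xgetPex (0 : subvs_of h) (killing_represents al); apply.
Qed.

Lemma dual_formE al be : dual_form al be = al (t_ be).
Proof. exact: killing_dualP. Qed.

Lemma dual_formC al be : dual_form al be = dual_form be al.
Proof. exact: killingC. Qed.

Lemma dual_formDl al be nu :
  dual_form (al + be) nu = dual_form al nu + dual_form be nu.
Proof. by rewrite !dual_formE add_lfunE. Qed.

Lemma dual_formNl al be : dual_form (- al) be = - dual_form al be.
Proof. by rewrite !dual_formE opp_lfunE. Qed.

Lemma dual_formNr al be : dual_form al (- be) = - dual_form al be.
Proof. by rewrite dual_formC dual_formNl dual_formC. Qed.

Lemma dual_formMnl al be n : dual_form (al *+ n) be = dual_form al be *+ n.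
Proof.
elim: n => [|n IHn]; first by rewrite !mulr0n dual_formE zero_lfunE.
by rewrite !mulrS dual_formDl IHn.
Qed.

Lemma subvs_eq0 H : (forall al, (al H : C) = 0) -> H = 0.
Proof.
move=> H0; rewrite (coord_vbasis (memvf H)) big1 // => i _.
have := H0 (linfun (coord (vbasis {:subvs_of h}) i : _ -> C^o)).
by rewrite lfunE /= => ->; rewrite scale0r.
Qed.

Lemma root_space0_sub x : x \in root_space (0 : dual) -> x \in h.
Proof.
have [_ h_max _] := h_cartan => /root_spaceP x0; apply: h_max => y yh.
by have := x0 (vsproj h y); rewrite vsprojK // zero_lfunE scale0r.
Qed.

Lemma root_space_pairing al x : x \in root_space al -> x != 0 ->
  exists2 y, y \in root_space (- al) & killing x y = 1.
Proof.
move=> xal x0.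
have [e [be [_ e_be e_span _]]] := cartan_eigenbasis h_cartan.
have [i xi] : exists i, killing x (e i) != 0.
  apply: contrapT => /forallNP xe; case/eqP: x0; apply: killing_nondeg => z.
  have [c ->] := e_span z; rewrite linear_sum big1 // => i _.
  by rewrite linearZ; have /negP/negPn/eqP /= -> := xe i; rewrite scaler0.
have bei : be i = - al.
  apply/eqP; rewrite -addr_eq0 addrC; apply/eqP; apply: contrapT => ab0.
  by rewrite (killing_root_space xal (e_be i) ab0) eqxx in xi.
have ei := e_be i; rewrite bei in ei.
exists ((killing x (e i))^-1 *: e i); first exact: memvZ.
by rewrite killingZr mulVf.
Qed.

Lemma lie_root_pair al x y : x \in root_space al -> y \in root_space (- al) ->
  killing x y = 1 -> lie x y = vsval (t_ al).
Proof.
move=> xal yal xy1.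
have xyh : lie x y \in h.
  have := lie_root_space xal yal; rewrite subrr; exact: root_space0_sub.
rewrite -(vsprojK xyh); congr vsval; apply/eqP; rewrite -subr_eq0; apply/eqP.
apply: subvs_eq0 => be; rewrite linearB /= -!killing_dualP vsprojK //.
rewrite killingC killing_lie; have /root_spaceP yV := yal.
rewrite lie_opp yV.
rewrite -scaleNr killingZr xy1 mulr1 opp_lfunE opprK.
by rewrite !killing_dualP -!dual_formE dual_formC subrr.
Qed.

(* [x y^(n+1) v = ((n+1) nu(t_al) - n(n+1)/2 al(t_al)) y^n v], and some
   [y^(n+1) v] vanishes first. *)
Lemma highest_weight_string al nu x v :
  al <> 0 -> x \in root_space al -> x != 0 ->
  v \in root_space nu -> v != 0 -> lie x v = 0 ->
  exists n : nat, dual_form nu al *+ 2 = dual_form al al *+ n.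
Proof.
move=> al0 xal x0 vnu v0 xv0.
have [y yal xy1] := root_space_pairing xal x0.
have xyE := lie_root_pair xal yal xy1.
pose w n := iter n (lie y) v.
have wV n : w n \in root_space (nu + (- al) *+ n).
  exact: iter_lie_root_space n yal vnu.
have tw n : lie (vsval (t_ al)) (w n) =
    (dual_form nu al - dual_form al al *+ n) *: w n.
  have /root_spaceP -> := wV n.
  rewrite -dual_formE dual_formDl dual_formMnl dual_formNl mulNrn //.
have xw n : lie x (w n.+1) *+ 2 =
    ((dual_form nu al *+ 2 - dual_form al al *+ n) *+ n.+1) *: w n.
  elim: n => [|n IHn].
    rewrite [w 1%N]/w /= lie_lie xyE xv0 linear0 addr0 (tw 0%N).
    by rewrite !mulr0n !subr0 mulr1n -scalerMnl.
  rewrite [w n.+2]/w iterS -/(w n.+1) lie_lie xyE tw mulrnDl.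
  have /= := congr1 (lie y) IHn; rewrite linearMn linearZ /= => ->.
  by rewrite scalerMnl -scalerDl string_coefficient.
have nal0 : - al <> 0 by move=> /eqP; rewrite oppr_eq0 => /eqP.
have [n [wn0 wn1]] := iter_lie_eventually0 nal0 yal vnu v0.
exists n; have /eqP := xw n.
rewrite [w n.+1]wn1 linear0 mul0rn eq_sym scaler_eq0 (negPf wn0) orbF.
by rewrite mulrn_eq0 /= subr_eq0 => /eqP.
Qed.

Lemma root_vector al : lie_roots al -> exists2 x, x \in root_space al & x != 0.
Proof.
case=> _ /eqP al0; exists (vpick (root_space al)); first exact: memv_pick.
by rewrite vpick0.
Qed.

Lemma lie_rootsI al x : al <> 0 -> x \in root_space al -> x != 0 -> lie_roots al.
Proof. by move=> al0 xal x0; split=> // E; rewrite E memv0 (negPf x0) in xal. Qed.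

Lemma lie_rootsN al : lie_roots al -> lie_roots (- al).
Proof.
move=> al_root; have [x xal x0] := root_vector al_root.
have [y yal xy1] := root_space_pairing xal x0.
apply: (lie_rootsI _ yal); first by move/eqP; rewrite oppr_eq0 => /eqP; case: al_root.
by apply/eqP => y0; move/eqP: xy1; rewrite y0 linear0 eq_sym oner_eq0.
Qed.

Definition weight be := exists2 v, v \in root_space be & v != 0.

Lemma dual_form_int al be : lie_roots al -> weight be ->
  exists m : int, dual_form be al *+ 2 = dual_form al al *~ m.
Proof.
move=> al_root [v vbe v0]; have [x xal x0] := root_vector al_root.
have al0 : al <> 0 by case: al_root.
have [n [w0 w1]] := iter_lie_eventually0 al0 xal vbe v0.
have wV := iter_lie_root_space n xal vbe.
have [m] := highest_weight_string al0 xal x0 wV w0 w1.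
rewrite dual_formDl dual_formMnl => E.
exists (m%:Z - (n * 2)%N%:Z).
rewrite mulrzBr -!pmulrn -E mulrnDl -mulrnA.
by rewrite addrK.
Qed.

Lemma dual_form_sumsq : exists be : 'I_(\dim {:g}) -> dual,
  (forall i, weight (be i)) /\
  forall al nu, dual_form al nu =
    \sum_i dual_form (be i) al * dual_form (be i) nu.
Proof.
have [e [be [e0 eV _ K]]] := cartan_eigenbasis h_cartan.
exists be; split=> [i|al nu]; first by exists (e i); [exact: eV|exact: e0].
by rewrite /dual_form K; apply: eq_bigr => i _; rewrite -!dual_formE.
Qed.

Lemma dual_form_eq0 nu : (forall be, weight be -> dual_form be nu = 0) -> nu = 0.
Proof.
move=> nu0; apply/lfunP => H; rewrite zero_lfunE -killing_dualP.
have [e [be [e0 eV _ ->]]] := cartan_eigenbasis h_cartan.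
rewrite big1 // => i _; rewrite -dual_formE nu0 ?mul0r //.
by exists (e i); [exact: eV|exact: e0].
Qed.

Lemma dual_form_gt0 nu : nu <> 0 ->
  (forall be, weight be -> dual_form be nu \is Num.real) ->
  0 < dual_form nu nu.
Proof.
move=> nu0 nu_real; have [be [wbe K]] := dual_form_sumsq.
have sq_ge0 be' : weight be' -> 0 <= dual_form be' nu * dual_form be' nu.
  by move=> /nu_real; rewrite -expr2 => /real_exprn_even_ge0; apply.
rewrite lt_neqAle [X in _ && (_ <= X)]K sumr_ge0 ?andbT; last first.
  by move=> i _; exact: sq_ge0.
apply/eqP => nunu; apply: nu0; apply: dual_form_eq0 => be' wbe'.
have be_nu i : dual_form (be i) nu = 0.
  have sum0 := etrans (esym (K nu nu)) (esym nunu).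
  have /eqP := @psumr_eq0P _ _ xpredT _ (fun j _ => sq_ge0 _ (wbe j)) sum0 i isT.
  by rewrite mulf_eq0 orbb => /eqP.
by rewrite K big1 // => i _; rewrite be_nu mulr0.
Qed.

Lemma root_form_neq0 al : lie_roots al -> dual_form al al != 0.
Proof.
move=> al_root; apply/eqP => aa0; case: (al_root) => + _; apply.
apply: dual_form_eq0 => be /(dual_form_int al_root)[m].
by rewrite aa0 mul0rz => /eqP; rewrite mulrn_eq0 => /eqP.
Qed.

(* [c = (al, al)] satisfies [c = c^2 S] with [S] a sum of squares of rationals. *)
Lemma root_form_gt0 al : lie_roots al -> 0 < dual_form al al.
Proof.
move=> al_root; have c0 := root_form_neq0 al_root.
have [be [wbe K]] := dual_form_sumsq.
pose c := dual_form al al; pose r i := dual_form (be i) al / c.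
have r_real i : r i \is Num.real.
  have [m E] := dual_form_int al_root (wbe i).
  have -> : r i = m%:~R / 2.
    rewrite /r; apply/eqP; rewrite eqr_div // ?pnatr_eq0 //.
    by rewrite mulr_natr E -mulrzl.
  by rewrite rpred_div ?rpred_int ?realn.
have E : c = c * c * \sum_i r i ^+ 2.
  rewrite {1}/c K mulr_sumr; apply: eq_bigr => i _.
  by rewrite -!expr2 -exprMn /r mulrC divfK.
have cS : c * \sum_i r i ^+ 2 = 1 by apply: (mulfI c0); rewrite mulr1 mulrA -E.
have S_gt0 : 0 < \sum_i r i ^+ 2.
  rewrite lt_neqAle sumr_ge0 ?andbT => [|i _]; last exact: real_exprn_even_ge0.
  by apply/eqP => S0; move/eqP: cS; rewrite -S0 mulr0 eq_sym oner_eq0.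
by rewrite -(pmulr_lgt0 c S_gt0) cS.
Qed.

Lemma root_form_real al be : lie_roots al -> weight be ->
  dual_form be al \is Num.real.
Proof.
move=> al_root wbe; have [m E] := dual_form_int al_root wbe.
have -> : dual_form be al = dual_form al al * m%:~R / 2.
  by apply: (canRL (mulfK _)); rewrite ?pnatr_eq0 // mulr_natr E mulrzr.
by rewrite rpred_div ?rpredM ?rpred_int ?realn ?gtr0_real ?root_form_gt0.
Qed.

Lemma root_subr_form_gt0 al be : lie_roots al -> lie_roots be -> al <> be ->
  0 < dual_form (al - be) (al - be).
Proof.
move=> al_root be_root ab; apply: dual_form_gt0 => [/eqP|nu wnu].
  by rewrite subr_eq0 => /eqP.
by rewrite dual_formC dual_formDl dual_formNl rpredB // dual_formC root_form_real.
Qed.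

Lemma lie_rootsB al be : lie_roots al -> lie_roots be -> al <> be ->
  0 < dual_form al be -> lie_roots (al - be).
Proof.
move=> al_root be_root ab; apply: contraPP => ab_root.
have nbe_root := lie_rootsN be_root.
have [x xbe x0] := root_vector nbe_root; have [v val v0] := root_vector al_root.
have xv : lie x v = 0.
  have xvV := lie_root_space xbe val; apply/eqP; apply: contra_notT ab_root.
  by rewrite addrC in xvV; apply: lie_rootsI xvV => /eqP; rewrite subr_eq0 => /eqP.
have [nbe0 _] := nbe_root.
have [n] := highest_weight_string nbe0 xbe x0 val v0 xv.
rewrite !dual_formNr dual_formNl opprK mulNrn => E.
have be_ge0 : 0 <= dual_form be be *+ n := mulrn_wge0 n (ltW (root_form_gt0 be_root)).
move: be_ge0; rewrite -E oppr_ge0 => ab_le0 ab_gt0.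
have : 0 < dual_form al be *+ 2 by rewrite pmulrn_lgt0.
by move/lt_le_trans => /(_ _ ab_le0); rewrite ltxx.
Qed.

End Strings.

Section LongRoots.
Variables (F : realFieldType) (V : zmodType) (Phi : V -> Prop) (B : V -> V -> F).
Hypothesis BC : forall a b, B a b = B b a.
Hypothesis BD : forall a b c, B (a + b) c = B a c + B b c.
Hypothesis B_gt0 : forall a, Phi a -> 0 < B a a.
Hypothesis B_sub_gt0 : forall a b,
  Phi a -> Phi b -> a <> b -> 0 < B (a - b) (a - b).
Hypothesis B_int : forall a b, Phi a -> Phi b ->
  exists m : int, B b a *+ 2 = B a a *~ m.
Hypothesis PhiN : forall a, Phi a -> Phi (- a).
Hypothesis PhiB : forall a b, Phi a -> Phi b -> a <> b -> 0 < B a b -> Phi (a - b).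

Let BNl u w : B (- u) w = - B u w.
Proof.
apply/eqP; rewrite -addr_eq0 -BD addNr; apply/eqP.
by apply: (addrI (B 0 w)); rewrite -BD !addr0.
Qed.

Let BB a b : B (a - b) (a - b) = B a a - B a b *+ 2 + B b b.
Proof.
by rewrite BD BNl ![B _ (a - b)]BC !BD !BNl (BC b a); ring.
Qed.

Lemma long_root_form_le a b : Phi a -> Phi b -> a <> b -> B b b <= B a a ->
  B b a *+ 2 <= B a a.
Proof.
move=> Pa Pb ab ba; have [m E] := B_int Pa Pb; have a0 := B_gt0 Pa.
have : B b a *+ 2 < B a a *+ 2.
  by have := B_sub_gt0 Pa Pb ab; rewrite BB (BC a b); move: ba; lra.
rewrite E -[_ *+ 2]/(_ *~ 2%:Z) ltr_pMz2l // => m2.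
have m1 : m <= 1 by rewrite -ltzD1.
by rewrite -[leRHS]mulr1z ler_pMz2l.
Qed.

Lemma long_sum_summand mu eps gj be :
  Phi mu -> Phi eps -> Phi gj -> Phi be ->
  (forall a, Phi a -> B a a <= B mu mu) ->
  (forall a, Phi a -> B a a <= B eps eps) ->
  mu <> - eps -> ~ Phi (mu + eps) -> gj + be = mu + eps ->
  gj <> mu -> gj <> eps -> gj <> be ->
  B (mu + eps) gj = B mu mu /\ B gj gj = B mu mu.
Proof.
move=> Pm Pe Pg Pb m_long e_long m_ne s_root E gm ge gb.
have bm : be <> mu by move=> bm; apply: ge; apply: (addIr be); rewrite E bm addrC.
have b_e : be <> eps by move=> b_e; apply: gm; apply: (addIr be); rewrite E b_e.
have M0 := B_gt0 Pm; have G0 := B_gt0 Pg.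
have eM : B eps eps = B mu mu by apply/eqP; rewrite eq_le m_long ?e_long.
have me0 : 0 <= B mu eps.
  rewrite leNgt; apply/negP => me; apply: s_root; rewrite -[eps]opprK.
  apply: PhiB => //; first exact: PhiN.
  by rewrite BC BNl BC oppr_gt0.
have leb a b : Phi a -> Phi b -> b <> a -> B b b <= B a a -> B b a *+ 2 <= B a a.
  by move=> Pa Pb' /nesym ab; exact: long_root_form_le.
have gm2 := leb _ _ Pm Pg gm (m_long _ Pg).
have bm2 := leb _ _ Pm Pb bm (m_long _ Pb).
have ge2 := leb _ _ Pe Pg ge (e_long _ Pg).
have be2 := leb _ _ Pe Pb b_e (e_long _ Pb).
have Em : B gj mu + B be mu = B mu mu + B mu eps by rewrite -BD E BD (BC eps).
have Ee : B gj eps + B be eps = B mu eps + B eps eps by rewrite -BD E BD.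
have Eg : B gj gj + B gj be = B gj mu + B gj eps.
  by rewrite (BC gj be) (BC gj mu) (BC gj eps) -!BD E.
have Eb : B gj be + B be be = B be mu + B be eps.
  by rewrite (BC be mu) (BC be eps) -!BD E.
have gb2 : B be gj *+ 2 <= B gj gj.
  apply: leb => //; first by apply: nesym.
  by move: gm2 bm2 ge2 be2 Em Ee Eg Eb; rewrite eM; lra.
have [k Ek] := B_int Pg Pm.
have k1 : k <= 1.
  rewrite -ltzD1 -(ltr_pMz2l G0) -Ek -[_ *~ (1 + 1)]/(_ *+ 2) (BC mu).
  by move: G0 gm2 bm2 ge2 be2 gb2 Em Ee Eg Eb; rewrite eM (BC be gj); lra.
have MG : B gj gj = B mu mu.
  apply/eqP; rewrite eq_le m_long //=; have : B mu gj *+ 2 <= B gj gj *~ 1.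
    by rewrite Ek ler_pMz2l.
  by rewrite mulr1z BC; move: gm2 bm2 ge2 be2 Em Ee; rewrite eM; lra.
split=> //; rewrite BD (BC mu gj) (BC eps gj).
by move: gm2 bm2 ge2 be2 Em Ee Eg; rewrite eM; lra.
Qed.

Lemma long_sum_difference_root mu eps al gj :
  Phi mu -> Phi eps ->
  (forall a, Phi a -> B a a <= B mu mu) ->
  (forall a, Phi a -> B a a <= B eps eps) ->
  mu <> - eps -> ~ Phi (mu + eps) ->
  Phi gj -> Phi (mu + eps - gj) ->
  gj <> mu -> gj <> eps -> gj <> mu + eps - gj ->
  Phi al -> Phi (mu + eps - al) ->
  gj <> al -> gj <> mu + eps - al ->
  Phi (gj - al).
Proof.
move=> Pm Pe m_long e_long m_ne s_root Pg Pb gm ge gb Pa Pa' ga ga'.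
have sum_sub a : a + (mu + eps - a) = mu + eps by rewrite addrC subrK.
have [sg gg] := long_sum_summand Pm Pe Pg Pb m_long e_long m_ne s_root
  (sum_sub _) gm ge gb.
have g_long a : Phi a -> B a a <= B gj gj by rewrite gg; exact: m_long.
have := long_root_form_le Pg Pa' ga' (g_long _ Pa').
have : B al gj + B (mu + eps - al) gj = B mu mu by rewrite -BD sum_sub.
have := B_gt0 Pm; rewrite gg => M0 aE a'_le.
by apply: PhiB => //; rewrite BC; move: M0 aE a'_le; lra.
Qed.

End LongRoots.

Section Simple.
Variables (R : realType) (g : lieAlgebraType R[i]) (h : {vspace g}).
Local Notation C := R[i].
Local Notation dual := (dual h).
Hypothesis g_simple : simple_lie g.
Variables (T : cartan_type) (Pi : (cartan_rank T).-tuple dual).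
Hypothesis Pi_type : has_type Pi.
Implicit Types (al be nu : dual) (i j q : 'I_(cartan_rank T)).

(* The Cartan entry [2 * x / x] is [2], whereas division by [0] gives [0]. *)
Lemma simple_root_form_neq0 j : dual_form (tnth Pi j) (tnth Pi j) != 0.
Proof.
case: Pi_type => _ _ /(_ j j); rewrite /cartan_entry eqxx => E.
apply/eqP => x0; move/eqP: E; rewrite x0 mulr0 mul0r eq_sym.
by rewrite intr_eq0.
Qed.

Lemma simple_root_represented j : exists t : subvs_of h,
  forall H : subvs_of h, killing (vsval t) (vsval H) = (tnth Pi j H : C).
Proof.
apply: contrapT => /forallNP no_t; have /eqP := simple_root_form_neq0 j; apply.
by rewrite /dual_form /killing_dual xgetPN ?linear0.
Qed.

Lemma killing_represents al : exists t : subvs_of h,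
  forall H : subvs_of h, killing (vsval t) (vsval H) = (al H : C).
Proof.
have [_ [Pi_basis _ _] _] := Pi_type.
have /choice[t tE] := simple_root_represented.
exists (\sum_j coord Pi j al *: t j) => H.
rewrite [in RHS](coord_basis Pi_basis (memvf al)) sum_lfunE.
rewrite linear_sum killingC linear_sum; apply: eq_bigr => j _.
by rewrite !linearZ /= killingC tE scale_lfunE (tnth_nth 0).
Qed.

Lemma killing_nondeg (q : 'I_(cartan_rank T)) (x : g) :
  (forall y, killing x y = 0) -> x = 0.
Proof.
apply: simple_killing_nondeg => //.
pose t := vsval (killing_dual (tnth Pi q)).
by exists t, t; exact: simple_root_form_neq0.
Qed.

Lemma graded_weight q k nu v : v \in root_space nu -> v != 0 ->
  v \in graded Pi q k -> lie_roots nu /\ coord Pi q nu = k%:R.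
Proof.
move=> vnu v0 vk; have [h_cartan _ _] := Pi_type.
have [w wnu vw] := root_space_pairing h_cartan (@killing_nondeg q) vnu v0.
by apply: sum_root_spaces_mem vnu vk wnu _; rewrite killingC vw oner_eq0.
Qed.

Lemma roots_of_graded q k nu :
  roots_of (graded Pi q k) nu -> lie_roots nu /\ coord Pi q nu = k%:R.
Proof.
case=> nu_root /subvP nu_k; have [x xnu x0] := root_vector nu_root.
exact: graded_weight xnu x0 (nu_k _ xnu).
Qed.

Lemma highest_weight_graded q k nu :
  highest_weight_in_g Pi q (graded Pi q k) nu ->
  lie_roots nu /\ coord Pi q nu = k%:R.
Proof.
case=> v [vk /eqP v0 v_wt _]; apply: graded_weight v0 vk.
by apply/root_spaceP => H; rewrite -v_wt lfunE.
Qed.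

End Simple.

Theorem lemma6p33 (R : realType) (g : lieAlgebraType R[i]) (h : {vspace g})
    (T : cartan_type) (Pi : (cartan_rank T).-tuple (dual h))
    (q : 'I_(cartan_rank T)) (mu gam eps : dual h) :
  simple_lie g ->
  has_type Pi ->
  quasi_heisenberg Pi q ->
  lemma_types T q.+1 ->
  highest_weight_in_g Pi q (g1 Pi q) mu ->
  highest_weight_in_g Pi q (zn Pi q) gam ->
  roots_of (g1 Pi q) eps ->
  special Pi q mu gam (mu + eps) ->
  type1a mu eps ->
  forall al gj : dual h,
    roots_of_at (mu + eps) (g1 Pi q) al ->
    roots_of_at (mu + eps) (zn Pi q) gj ->
    lie_roots (gj - al).
Proof.
move=> g_simple Pi_type _ _ mu_hw _ eps_g1 _ [s_root _ mu_long eps_long].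
move=> al gj [al_g1 al'_root] [gj_zn be_root].
have [h_cartan _ _] := Pi_type.
have nondeg := killing_nondeg g_simple Pi_type q.
have repr := killing_represents Pi_type.
have [mu_root mu1] := highest_weight_graded g_simple Pi_type mu_hw.
have [eps_root eps1] := roots_of_graded g_simple Pi_type eps_g1.
have [al_root al1] := roots_of_graded g_simple Pi_type al_g1.
have [gj_root gj2] := roots_of_graded g_simple Pi_type gj_zn.
have wt (be : dual h) : lie_roots be -> weight be.
  by move=> /root_vector[x xbe x0]; exists x.
pose B (a b : dual h) : R := complex.Re (dual_form a b).
have formE a b : lie_roots a -> lie_roots b -> dual_form a b = (B a b)%:C%C.
  move=> a_root b_root; apply: esym.
  exact: RRe_real (root_form_real h_cartan nondeg repr b_root (wt a a_root)).
have long_form a : long_root a -> forall b, lie_roots b -> B b b <= B a a.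
  by case=> _ a_long b /a_long; rewrite lecE => /andP[].
have coord_neq a b (m n : nat) : coord Pi q a = m%:R -> coord Pi q b = n%:R ->
    m != n -> a <> b.
  move=> a_m b_n mn ab; move: a_m; rewrite ab b_n => /eqP.
  by rewrite eqr_nat eq_sym (negPf mn).
have BC a b : B a b = B b a by rewrite /B dual_formC.
have BD a b c : B (a + b) c = B a c + B b c.
  by rewrite /B (dual_formDl repr) raddfD.
have B_gt0 a : lie_roots a -> 0 < B a a.
  by move=> /(root_form_gt0 h_cartan nondeg repr); rewrite ltcE => /andP[].
have B_sub_gt0 a b : lie_roots a -> lie_roots b -> a <> b ->
    0 < B (a - b) (a - b).
  move=> a_root b_root ab.
  have := root_subr_form_gt0 h_cartan nondeg repr a_root b_root ab.
  by rewrite ltcE => /andP[].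
have B_int a b : lie_roots a -> lie_roots b ->
    exists m : int, B b a *+ 2 = B a a *~ m.
  move=> a_root b_root.
  have [m E] := dual_form_int h_cartan nondeg repr a_root (wt b b_root).
  by exists m; rewrite /B -raddfMn -raddfMz E.
have PhiN := lie_rootsN h_cartan nondeg.
have PhiB a b : lie_roots a -> lie_roots b -> a <> b -> 0 < B a b ->
    lie_roots (a - b).
  move=> a_root b_root ab Bab.
  have ab_gt0 : 0 < dual_form a b.
    by rewrite (formE a b a_root b_root) ltcE /= eqxx.
  exact: lie_rootsB h_cartan nondeg repr a b a_root b_root ab ab_gt0.
have coordB a : coord Pi q (mu + eps - a) = 2%:R - coord Pi q a.
  by rewrite linearB linearD /= mu1 eps1.
have gj'0 : coord Pi q (mu + eps - gj) = 0%:R by rewrite coordB gj2 subrr.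
have al'1 : coord Pi q (mu + eps - al) = 1%:R by rewrite coordB al1 -natrB.
have m_ne : mu <> - eps.
  have sum2 : coord Pi q (mu + eps) = 2%:R by rewrite linearD /= mu1 eps1.
  move=> /eqP; rewrite -addr_eq0 => /eqP.
  exact: coord_neq (mu + eps) 0 2 0 sum2 (linear0 _) isT.
exact: (long_sum_difference_root BC BD B_gt0 B_sub_gt0 B_int PhiN PhiB
  mu_root eps_root (long_form mu mu_long) (long_form eps eps_long)
  m_ne s_root gj_root be_root
  (coord_neq gj mu 2 1 gj2 mu1 isT) (coord_neq gj eps 2 1 gj2 eps1 isT)
  (coord_neq gj (mu + eps - gj) 2 0 gj2 gj'0 isT) al_root al'_root
  (coord_neq gj al 2 1 gj2 al1 isT)
  (coord_neq gj (mu + eps - al) 2 1 gj2 al'1 isT)).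
Qed.
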